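(* Let $J\in\mathbb{C}^{2\times 2}$ be a unitary matrix, written as $J=e^{i\phi}\begin{pmatrix}\alpha&-\bar\beta\\ \beta&\bar\alpha\end{pmatrix}$ with $\phi\in[0,\pi)$, $\alpha,\beta\in\mathbb{C}$, $|\alpha|^2+|\beta|^2=1$, and let $G(t,x,y)$, $t>0$, $x,y\in\mathbb{R}\setminus\{0\}$, be the associated Green's function (defined in the context through the coefficients $\omega_\pm,\mu_\pm^{(x,y)},\mu_0^{(x,y)}$ determined by $J$). Then for every fixed $y\in\mathbb{R}\setminus\{0\}$ the function $G$ satisfies the differential equation $$i\frac{\partial}{\partial t}G(t,x,y)=-\frac{\partial^2}{\partial x^2}G(t,x,y),\qquad t>0,\ x\in\mathbb{R}\setminus\{0\},$$ as well as the jump condition $$(I-J)\begin{pmatrix}G(t,0^+,y)\\ G(t,0^-,y)\end{pmatrix}=i(I+J)\begin{pmatrix}\frac{\partial}{\partial x}G(t,0^+,y)\\ -\frac{\partial}{\partial x}G(t,0^-,y)\end{pmatrix},\qquad t>0.$$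
   Context: Conventions: $I$ is the $2\times2$ identity matrix; for $t>0$, $\sqrt{it}=e^{i\pi/4}\sqrt t$ and $\sqrt{i\pi t}=e^{i\pi/4}\sqrt{\pi t}$ (principal branch); $\Theta(x)=1$ for $x>0$ and $\Theta(x)=0$ for $x<0$; $g(0^\pm)$ denotes the one-sided limit $\lim_{x\to0^\pm}g(x)$. The entire function $\Lambda$ is $\Lambda(z)=e^{z^2}(1-\operatorname{erf}(z))$, where $\operatorname{erf}(z)=\frac{2}{\sqrt\pi}\int_0^z e^{-\xi^2}d\xi$. Coefficients. Every unitary $J\in\mathbb{C}^{2\times2}$ has the form $J=e^{i\phi}\begin{pmatrix}\alpha&-\bar\beta\\ \beta&\bar\alpha\end{pmatrix}$ with $\phi\in[0,\pi)$ and $|\alpha|^2+|\beta|^2=1$. For $x,y\in\mathbb{R}\setminus\{0\}$ put $\eta^{(x,y)}=0$ if $|\operatorname{Re}(\alpha)|=1$, and if $|\operatorname{Re}(\alpha)|\neq1$ put $$\eta^{(x,y)}=\frac{1}{\sqrt{1-\operatorname{Re}(\alpha)^2}}\cdot\begin{cases}-\operatorname{Im}(\alpha),&x,y>0,\\ -i\bar\beta,&x>0,\,y<0,\\ i\beta,&x<0,\,y>0,\\ \operatorname{Im}(\alpha),&x,y<0.\end{cases}$$ Case I: if $\operatorname{Re}(\alpha)\neq-\cos(\phi)$, then $\omega_\pm=\frac{-\sin(\phi)\pm\sqrt{1-\operatorname{Re}(\alpha)^2}}{\cos(\phi)+\operatorname{Re}(\alpha)}$, $\mu_\pm^{(x,y)}=-\frac{\omega_\pm}{2}\big(\Theta(xy)\pm\eta^{(x,y)}\big)$,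 $\mu_0^{(x,y)}=\operatorname{sgn}(xy)$. Case II: if $\operatorname{Re}(\alpha)=-\cos(\phi)\neq-1$, then $\omega_-=\mu_-^{(x,y)}=0$, $\omega_+=\cot(\phi)$, $\mu_+^{(x,y)}=-\frac{\omega_+}{2}\big(\Theta(xy)+\eta^{(x,y)}\big)$, $\mu_0^{(x,y)}=\eta^{(x,y)}-\Theta(-xy)$. Case III: if $\operatorname{Re}(\alpha)=-\cos(\phi)=-1$, then $\omega_\pm=\mu_\pm^{(x,y)}=0$ and $\mu_0^{(x,y)}=-1$. Green's function: for $t>0$, $x,y\in\mathbb{R}\setminus\{0\}$, $$G(t,x,y)=\Big(\mu_+^{(x,y)}\Lambda\Big(\tfrac{|x|+|y|}{2\sqrt{it}}+\omega_+\sqrt{it}\Big)+\mu_-^{(x,y)}\Lambda\Big(\tfrac{|x|+|y|}{2\sqrt{it}}+\omega_-\sqrt{it}\Big)\Big)e^{-\frac{(|x|+|y|)^2}{4it}}+\frac{1}{2\sqrt{i\pi t}}\Big(\mu_0^{(x,y)}e^{-\frac{(|x|+|y|)^2}{4it}}+e^{-\frac{(x-y)^2}{4it}}\Big).$$ *)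

(* Defs.v *)
From Stdlib Require Export Reals.
From Coquelicot Require Export Coquelicot.

Open Scope R_scope.

Definition Cexp (z : C) : C := (exp (Re z) * cos (Im z), exp (Re z) * sin (Im z)).

(* The complex line integral from 0 to z, taken along the segment s |-> s z;
   the integrand is entire, so the path is immaterial. *)
Definition Cerf (z : C) : C :=
  (RtoC (2 / sqrt PI) *
   @RInt C_R_CompleteNormedModule
     (fun s : R => (z * Cexp (- ((RtoC s * z) * (RtoC s * z))))%C) 0 1)%C.

Definition Lambda (z : C) : C := (Cexp (z * z) * (RtoC 1 - Cerf z))%C.

(* sqrt (i s) = e^(i pi/4) sqrt s for s > 0. *)
Definition sqrt_i (s : R) : C :=
  (Cexp (Ci * RtoC (PI / 4)) * RtoC (sqrt s))%C.

Definition Mscal {m n : nat} (c : C) (A : @matrix C m n) : @matrix C m n :=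
  mk_matrix m n (fun i j => (c * coeff_mat (RtoC 0) A i j)%C).

Definition Madj {m n : nat} (A : @matrix C m n) : @matrix C n m :=
  mk_matrix n m (fun i j => Cconj (coeff_mat (RtoC 0) A j i)).

Definition unitary {n : nat} (A : @matrix C n n) : Prop :=
  Mmult (Madj A) A = Mone /\ Mmult A (Madj A) = Mone.

Definition Jmat (phi : R) (alpha beta : C) : @matrix C 2 2 :=
  Mscal (Cexp (Ci * RtoC phi))
    ([[alpha, (- Cconj beta)%C],
      [beta,  Cconj alpha]] : @matrix C 2 2).

(* Only used away from 0. *)
Definition Theta (x : R) : R := if Rlt_dec 0 x then 1 else 0.

Definition eta (alpha beta : C) (x y : R) : C :=
  if Req_EM_T (Rabs (Re alpha)) 1 then RtoC 0
  else
    (RtoC (1 / sqrt (1 - Re alpha ^ 2)) *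
     (if Rlt_dec 0 x then
        if Rlt_dec 0 y then RtoC (- Im alpha) else - Ci * Cconj beta
      else
        if Rlt_dec 0 y then Ci * beta else RtoC (Im alpha)))%C.

Record coefficients := Coefficients {
  omega_p : R;
  omega_m : R;
  mu_p : C;
  mu_m : C;
  mu_0 : C
}.

Definition coef (phi : R) (alpha beta : C) (x y : R) : coefficients :=
  if Req_EM_T (Re alpha) (- cos phi) then
    if Req_EM_T (Re alpha) (-1) then
      Coefficients 0 0 (RtoC 0) (RtoC 0) (RtoC (-1))
    else
      let wp := cos phi / sin phi in
      Coefficients wp 0
        (- RtoC (wp / 2) * (RtoC (Theta (x * y)) + eta alpha beta x y))%C
        (RtoC 0)
        (eta alpha beta x y - RtoC (Theta (- (x * y))))%C
  else
    let s := sqrt (1 - Re alpha ^ 2) in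
    let wp := (- sin phi + s) / (cos phi + Re alpha) in
    let wm := (- sin phi - s) / (cos phi + Re alpha) in
    Coefficients wp wm
      (- RtoC (wp / 2) * (RtoC (Theta (x * y)) + eta alpha beta x y))%C
      (- RtoC (wm / 2) * (RtoC (Theta (x * y)) - eta alpha beta x y))%C
      (RtoC (sign (x * y))).

Definition Green (phi : R) (alpha beta : C) (t x y : R) : C :=
  let c := coef phi alpha beta x y in
  let r := Rabs x + Rabs y in
  let E (d : R) := Cexp (- (RtoC (d ^ 2) / (RtoC 4 * Ci * RtoC t))) in
  let z (w : R) := (RtoC r / (RtoC 2 * sqrt_i t) + RtoC w * sqrt_i t)%C in
  ((mu_p c * Lambda (z (omega_p c)) + mu_m c * Lambda (z (omega_m c))) * E r
   + RtoC 1 / (RtoC 2 * sqrt_i (PI * t)) * (mu_0 c * E r + E (x - y)%R))%C.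

Definition is_derive_RC (f : R -> C) (x : R) (l : C) : Prop :=
  @is_derive R_AbsRing C_R_NormedModule f x l.

Definition lim_right0 (f : R -> C) (l : C) : Prop :=
  filterlim f (at_right 0) (locally l).

Definition lim_left0 (f : R -> C) (l : C) : Prop :=
  filterlim f (at_left 0) (locally l).

(* Main.v *)
Require Import Defs.
From Stdlib Require Import Lra.

(** The Green's function is a linear combination of two kinds of functions: the
    heat kernel K at imaginary time, and the layers
    W = Lambda(r / (2 sqrt (i t)) + w sqrt (i t)) exp(- r^2 / (4 i t)).  Since
    Lambda' = 2 z Lambda - 2 / sqrt pi, a layer satisfies the first-order
    equation W_r = w W - 2 K ([is_derive_layer_r]), and similarly in time
    ([is_derive_layer_t]).  With these identities the Schroedinger equation for
    W reduces to the one for K.  Linear combinations and the substitutions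
    r = s x + b with s^2 = 1 preserve the equation, and on each half-line
    the coefficients of the Green's function are constant ([Green_branch]).

    The derivative of Lambda needs that of the error function, given as an
    integral along the segment from 0 to z.  It is obtained componentwise, by
    differentiation under the integral sign ([is_derive_RInt_primitive]); the
    Cauchy-Riemann equations of the components turn it into a complex chain rule
    along curves ([is_derive_Cerf]).

    For the jump condition, write J = exp(i phi) (Re alpha + i H) with H
    Hermitian and traceless.  As functions of the sign of x, the vectors
    Theta +- eta are eigenvectors of H ([eta_eigen]), hence of J, and
    omega_+- is the number w with 1 - lambda = i w (1 + lambda) for the
    corresponding eigenvalue lambda of J ([eigenvalue_generic]).  On such a
    vector u the relation (I - J) u = i (I + J) v is solved by v = w u, which is
    the Robin condition that a layer satisfies up to a multiple of K.
    The coefficient mu_0 makes the multiples of K cancel.  When lambda = -1,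
    which is excluded by that formula for w, the vector u lies in the kernel of
    I + J and imposes a Dirichlet condition, met by the heat kernel and its
    mirror image alone.  The boundary data of the Green's function are a linear
    combination of these solutions ([coef_jump]). *)

(** * Derivatives of complex functions of a real variable *)
Lemma is_derive_RC_components (f : R -> C) (x : R) (l : C) :
  is_derive (fun u => Re (f u)) x (Re l) ->
  is_derive (fun u => Im (f u)) x (Im l) ->
  is_derive_RC f x l.
Proof.
  intros h1 h2.
  apply (is_derive_ext (fun u => (Re (f u), Im (f u)) : C_R_NormedModule)).
  { intros t. now destruct (f t). }
  unfold is_derive in *.
  apply filterdiff_ext_lin with (fun u : R => ((u * Re l, u * Im l) : C)).
  2:{ intros u. reflexivity. }
  apply (filterdiff_comp'_2 (fun u => Re (f u)) (fun u => Im (f u))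
     (fun a b : R => (a, b) : C_R_NormedModule) x (fun u => u * Re l) (fun u => u * Im l)
     (fun a b : R => (a, b) : C_R_NormedModule) h1 h2).
  apply filterdiff_linear.
  apply is_linear_prod; [apply is_linear_fst | apply is_linear_snd].
Qed.

Lemma is_derive_RC_Re (f : R -> C) (x : R) (l : C) :
  is_derive_RC f x l -> is_derive (fun u => Re (f u)) x (Re l).
Proof.
  intros h.
  apply (filterdiff_comp' f (fun z : C_R_NormedModule => fst z) x
    (fun u : R => scal u l : C_R_NormedModule)
    (fun z : C_R_NormedModule => fst z : R) h).
  apply filterdiff_linear, (is_linear_fst (U := R_NormedModule) (V := R_NormedModule)).
Qed.

Lemma is_derive_RC_Im (f : R -> C) (x : R) (l : C) :
  is_derive_RC f x l -> is_derive (fun u => Im (f u)) x (Im l).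
Proof.
  intros h.
  apply (filterdiff_comp' f (fun z : C_R_NormedModule => snd z) x
    (fun u : R => scal u l : C_R_NormedModule)
    (fun z : C_R_NormedModule => snd z : R) h).
  apply filterdiff_linear, (is_linear_snd (U := R_NormedModule) (V := R_NormedModule)).
Qed.

(** * The error function along curves *)

(** The parametric integrals behind the error function can be differentiated
    in closed form because the parameter derivative [df] of the integrand is
    also the [s]-derivative of an elementary [D]: after differentiation under
    the integral sign, the fundamental theorem of calculus evaluates the
    integral. *)
Lemma is_derive_RInt_primitive (f df D : R -> R -> R) (u : R) :
  (forall v s, is_derive (fun v => f v s) v (df v s)) ->
  (forall s, is_derive (fun s => D u s) s (df u s)) ->
  (forall v s, continuity_2d_pt df v s) ->
  (forall v, ex_RInt (f v) 0 1) ->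
  is_derive (fun v => RInt (f v) 0 1) u (D u 1 - D u 0).
Proof.
  intros hf hD hc hi.
  assert (hE : forall v s, Derive (fun v => f v s) v = df v s)
    by (intros; apply is_derive_unique, hf).
  replace (D u 1 - D u 0)
    with (RInt (fun s => Derive (fun v => f v s) u) 0 1).
  - apply is_derive_RInt_param.
    + apply filter_forall; intros v s _. eexists; apply hf.
    + intros s _. apply (continuity_2d_pt_ext df); [now intros | apply hc].
    + now apply filter_forall.
  - apply is_RInt_unique.
    apply (is_RInt_derive (V := R_CompleteNormedModule) (fun s => D u s)).
    + intros s _. rewrite hE. apply hD.
    + intros s _.
      apply (continuous_ext (fun s => df u s)); [now intros|].
      assert (h := proj1 (continuity_2d_pt_filterlim _ _ _) (hc u s)).
      apply (filterlim_comp _ _ _ (fun s => (u, s))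
               (fun z : R * R => df (fst z) (snd z)) _ (locally (u, s))); [|exact h].
      apply (continuous_comp_2 (V := R_UniformSpace) (fun _ : R => u)
               (fun s : R => s) (fun a b : R => (a, b)) s).
      * apply continuous_const.
      * apply continuous_id.
      * apply filterlim_ext with (fun z : R * R => z).
        -- now intros [].
        -- apply filterlim_id.
Qed.

(** Real and imaginary part of the integral over [0, 1] of z exp(- s^2 z^2),
    z = a + i b. *)
Definition erf_re (a b : R) : R :=
  RInt (fun s => exp (- (s ^ 2 * (a ^ 2 - b ^ 2)))
         * (a * cos (2 * s ^ 2 * a * b) + b * sin (2 * s ^ 2 * a * b))) 0 1.
Definition erf_im (a b : R) : R :=
  RInt (fun s => exp (- (s ^ 2 * (a ^ 2 - b ^ 2)))
         * (b * cos (2 * s ^ 2 * a * b) - a * sin (2 * s ^ 2 * a * b))) 0 1.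

Lemma ex_RInt_derivable (f : R -> R) (a b : R) :
  (forall x, ex_derive f x) -> ex_RInt f a b.
Proof.
  intros h. apply (ex_RInt_continuous (V := R_CompleteNormedModule)).
  intros x _. exact (ex_derive_continuous (V := R_NormedModule) f x (h x)).
Qed.

Lemma Cerf_components (a b : R) :
  Cerf (a, b) = (2 / sqrt PI * erf_re a b, 2 / sqrt PI * erf_im a b).
Proof.
  unfold Cerf.
  replace (RInt (V := C_R_CompleteNormedModule) _ 0 1) with (erf_re a b, erf_im a b).
  { unfold Cmult, RtoC; simpl. f_equal; ring. }
  symmetry. apply (is_RInt_unique (V := C_R_CompleteNormedModule)).
  apply (is_RInt_ext (V := C_R_NormedModule)
   (fun s => (exp (- (s ^ 2 * (a ^ 2 - b ^ 2)))
         * (a * cos (2 * s ^ 2 * a * b) + b * sin (2 * s ^ 2 * a * b)),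
         exp (- (s ^ 2 * (a ^ 2 - b ^ 2)))
         * (b * cos (2 * s ^ 2 * a * b) - a * sin (2 * s ^ 2 * a * b))))).
  { intros s _.
    replace (- (RtoC s * (a, b) * (RtoC s * (a, b))))%C
      with (- (s ^ 2 * (a ^ 2 - b ^ 2)), - (2 * s ^ 2 * a * b))
      by (unfold Cmult, Copp, RtoC; simpl; f_equal; ring).
    unfold Cexp, Cmult, Re, Im, fst, snd.
    rewrite cos_neg, sin_neg.
    f_equal; ring. }
  apply (is_RInt_fct_extend_pair (U := R_NormedModule) (V := R_NormedModule)); simpl;
    apply (RInt_correct (V := R_CompleteNormedModule)); apply ex_RInt_derivable;
    intros x; auto_derive; exact I.
Qed.

Ltac continuity_2d :=
  repeat first
    [ apply continuity_2d_pt_const | apply continuity_2d_pt_id1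
    | apply continuity_2d_pt_id2
    | apply continuity_2d_pt_plus | apply continuity_2d_pt_minus
    | apply continuity_2d_pt_opp | apply continuity_2d_pt_mult
    | apply (continuity_1d_2d_pt_comp exp);
      [apply derivable_continuous_pt, derivable_pt_exp|]
    | apply (continuity_1d_2d_pt_comp cos);
      [apply derivable_continuous_pt, derivable_pt_cos|]
    | apply (continuity_1d_2d_pt_comp sin);
      [apply derivable_continuous_pt, derivable_pt_sin|]].

(** [gauss_cos] and [- gauss_sin] are the real and imaginary part of
    s exp(- s^2 z^2), z = a + i b.  This function is the primitive that makes
    the integrals computable: the z-derivative of z exp(- s^2 z^2) and the
    s-derivative of s exp(- s^2 z^2) are both (1 - 2 s^2 z^2) exp(- s^2 z^2),
    whose components are [gauss_cos_ds] and [- gauss_sin_ds]. *)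
Definition gauss_cos (a b s : R) : R :=
  s * exp (- (s ^ 2 * (a ^ 2 - b ^ 2))) * cos (2 * s ^ 2 * a * b).
Definition gauss_sin (a b s : R) : R :=
  s * exp (- (s ^ 2 * (a ^ 2 - b ^ 2))) * sin (2 * s ^ 2 * a * b).

Definition gauss_cos_ds (a b s : R) : R :=
  exp (- (s ^ 2 * (a ^ 2 - b ^ 2))) *
  ((1 - 2 * s ^ 2 * (a ^ 2 - b ^ 2)) * cos (2 * s ^ 2 * a * b)
   - 4 * s ^ 2 * a * b * sin (2 * s ^ 2 * a * b)).
Definition gauss_sin_ds (a b s : R) : R :=
  exp (- (s ^ 2 * (a ^ 2 - b ^ 2))) *
  ((1 - 2 * s ^ 2 * (a ^ 2 - b ^ 2)) * sin (2 * s ^ 2 * a * b)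
   + 4 * s ^ 2 * a * b * cos (2 * s ^ 2 * a * b)).

(** Proves a partial derivative of [erf_re] or [erf_im] from a primitive [D] in
    the integration variable and its derivative [D']. *)
Ltac erf_partial D D' :=
  match goal with |- is_derive ?f ?u ?l =>
    replace l with (D u 1 - D u 0);
    [ apply (is_derive_RInt_primitive _ (fun v s => D' v s)  D)
    | unfold gauss_cos, gauss_sin; cbn beta; ring] end;
  [ intros; unfold gauss_cos, gauss_sin, gauss_cos_ds, gauss_sin_ds; auto_derive;
    [exact I | simpl; unfold Rminus; ring]
  | intros; unfold gauss_cos, gauss_sin, gauss_cos_ds, gauss_sin_ds; simpl; auto_derive;
    [exact I | simpl; unfold Rminus; ring]
  | intros; unfold gauss_cos_ds, gauss_sin_ds; simpl; continuity_2d
  | intros; apply ex_RInt_derivable; intros x; auto_derive; exact I].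

Lemma erf_re_a (a b : R) :
  is_derive (fun a => erf_re a b) a (gauss_cos a b 1).
Proof.
  unfold erf_re.
  erf_partial (fun a s => gauss_cos a b s) (fun a s => gauss_cos_ds a b s).
Qed.

Lemma erf_re_b (a b : R) :
  is_derive (fun b => erf_re a b) b (gauss_sin a b 1).
Proof.
  unfold erf_re.
  erf_partial (fun b s => gauss_sin a b s) (fun b s => gauss_sin_ds a b s).
Qed.
Lemma erf_im_a (a b : R) :
  is_derive (fun a => erf_im a b) a (- gauss_sin a b 1).
Proof.
  unfold erf_im.
  erf_partial (fun a s => - gauss_sin a b s) (fun a s => - gauss_sin_ds a b s).
Qed.
Lemma erf_im_b (a b : R) :
  is_derive (fun b => erf_im a b) b (gauss_cos a b 1).
Proof.
  unfold erf_im.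
  erf_partial (fun b s => gauss_cos a b s) (fun b s => gauss_cos_ds a b s).
Qed.

(** Continuity of one partial derivative suffices for total differentiability
    of [F] at the point, whence the chain rule along the curve (p, q). *)
Lemma is_derive_comp_partials (F : R -> R -> R) (dx : R -> R -> R) (p q : R -> R)
  (u dy p' q' : R) :
  (forall a b, is_derive (fun a => F a b) a (dx a b)) ->
  continuity_2d_pt dx (p u) (q u) ->
  is_derive (fun b => F (p u) b) (q u) dy ->
  is_derive p u p' -> is_derive q u q' ->
  is_derive (fun v => F (p v) (q v)) u (dx (p u) (q u) * p' + dy * q').
Proof.
  intros hx hc hy hp hq.
  assert (h : filterdiff (fun z : R * R => F (fst z) (snd z)) (locally (p u, q u))
    (fun z : R * R => plus (scal (fst z) (dx (p u) (q u))) (scal (snd z) dy))).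
  { apply (is_derive_filterdiff F _ _ dx dy).
    - apply filter_forall; intros z; apply hx.
    - exact hy.
    - exact (proj1 (continuity_2d_pt_filterlim _ _ _) hc). }
  assert (h2 := filterdiff_comp'_2 p q F u _ _
     (fun a b => plus (scal a (dx (p u) (q u))) (scal b dy)) hp hq h).
  unfold is_derive.
  apply (filterdiff_ext_lin _ _ _ h2).
  intros v. unfold scal, plus; simpl. unfold mult; simpl. ring.
Qed.

(** The partial derivatives of the two components satisfy the Cauchy-Riemann
    equations, so that they combine to one complex factor times [f']. *)
Lemma is_derive_Cerf (f : R -> C) (u : R) (f' : C) :
  is_derive_RC f u f' ->
  is_derive_RC (fun v => Cerf (f v)) u
    (RtoC (2 / sqrt PI) * Cexp (- (f u * f u)) * f')%C.
Proof.
  intros h.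
  assert (hp := is_derive_RC_Re _ _ _ h). assert (hq := is_derive_RC_Im _ _ _ h).
  assert (hE : Cexp (- (f u * f u)) =
     (gauss_cos (Re (f u)) (Im (f u)) 1, - gauss_sin (Re (f u)) (Im (f u)) 1)).
  { destruct (f u) as [a b]; unfold gauss_cos, gauss_sin; simpl.
    replace (- ((a, b) * (a, b)))%C with (- (1 ^ 2 * (a ^ 2 - b ^ 2)), - (2 * 1 ^ 2 * a * b))
      by (unfold Cmult, Copp; simpl; f_equal; ring).
    unfold Cexp, Re, Im, fst, snd. rewrite cos_neg, sin_neg. f_equal; simpl; ring. }
  assert (hC : forall v, Cerf (f v) =
    (2 / sqrt PI * erf_re (Re (f v)) (Im (f v)), 2 / sqrt PI * erf_im (Re (f v)) (Im (f v)))).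
  { intros v. rewrite <- Cerf_components. now destruct (f v). }
  rewrite hE.
  apply is_derive_RC_components.
  - apply (is_derive_ext (fun v => 2 / sqrt PI * erf_re (Re (f v)) (Im (f v)))).
    { intros v. now rewrite hC. }
    match goal with |- is_derive _ _ ?l => replace l with
      (2 / sqrt PI * (gauss_cos (Re (f u)) (Im (f u)) 1 * Re f'
        + gauss_sin (Re (f u)) (Im (f u)) 1 * Im f'))
      by (destruct f'; simpl; ring) end.
    apply (is_derive_scal (fun v => erf_re (Re (f v)) (Im (f v)))).
    apply (is_derive_comp_partials erf_re (fun a b => gauss_cos a b 1)); auto using erf_re_a, erf_re_b.
    unfold gauss_cos; simpl; continuity_2d.
  - apply (is_derive_ext (fun v => 2 / sqrt PI * erf_im (Re (f v)) (Im (f v)))).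
    { intros v. now rewrite hC. }
    match goal with |- is_derive _ _ ?l => replace l with
      (2 / sqrt PI * (- gauss_sin (Re (f u)) (Im (f u)) 1 * Re f'
        + gauss_cos (Re (f u)) (Im (f u)) 1 * Im f'))
      by (destruct f'; simpl; ring) end.
    apply (is_derive_scal (fun v => erf_im (Re (f v)) (Im (f v)))).
    apply (is_derive_comp_partials erf_im (fun a b => - gauss_sin a b 1)); auto using erf_im_a, erf_im_b.
    unfold gauss_sin; simpl; continuity_2d.
Qed.

(** * Rules of calculus for [is_derive_RC] *)

Lemma is_derive_RC_eq (f : R -> C) (x : R) (l l' : C) :
  is_derive_RC f x l -> l = l' -> is_derive_RC f x l'.
Proof. now intros h <-. Qed.

Lemma is_derive_RC_const (c : C) (x : R) : is_derive_RC (fun _ => c) x (RtoC 0).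
Proof. exact (is_derive_const (V := C_R_NormedModule) c x). Qed.

Lemma is_derive_RC_RtoC (f : R -> R) (x l : R) :
  is_derive f x l -> is_derive_RC (fun u => RtoC (f u)) x (RtoC l).
Proof.
  intros h. apply is_derive_RC_components; [exact h|].
  exact (is_derive_const (V := R_NormedModule) 0 x).
Qed.

Lemma is_derive_RC_plus (f g : R -> C) (x : R) (l m : C) :
  is_derive_RC f x l -> is_derive_RC g x m ->
  is_derive_RC (fun u => (f u + g u)%C) x (l + m)%C.
Proof. exact (is_derive_plus (V := C_R_NormedModule) f g x l m). Qed.

Lemma is_derive_RC_opp (f : R -> C) (x : R) (l : C) :
  is_derive_RC f x l -> is_derive_RC (fun u => (- f u)%C) x (- l)%C.
Proof. exact (is_derive_opp (V := C_R_NormedModule) f x l). Qed.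

Lemma is_derive_RC_mult (f g : R -> C) (x : R) (l m : C) :
  is_derive_RC f x l -> is_derive_RC g x m ->
  is_derive_RC (fun u => (f u * g u)%C) x (l * g x + f x * m)%C.
Proof.
  intros hf hg.
  assert (f1 := is_derive_RC_Re _ _ _ hf). assert (f2 := is_derive_RC_Im _ _ _ hf).
  assert (g1 := is_derive_RC_Re _ _ _ hg). assert (g2 := is_derive_RC_Im _ _ _ hg).
  assert (e : forall p q p' q', is_derive p x p' -> is_derive q x q' ->
     is_derive (fun u => p u * q u) x (p' * q x + p x * q')).
  { intros p q p' q' hp hq.
    exact (is_derive_mult p q x p' q' hp hq Rmult_comm). }
  apply is_derive_RC_components.
  - replace (Re _) with (Re l * Re (g x) + Re (f x) * Re m - (Im l * Im (g x) + Im (f x) * Im m))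
      by (destruct l, m, (f x), (g x); simpl; ring).
    exact (is_derive_minus (V := R_NormedModule) _ _ _ _ _ (e _ _ _ _ f1 g1) (e _ _ _ _ f2 g2)).
  - replace (Im _) with (Re l * Im (g x) + Re (f x) * Im m + (Im l * Re (g x) + Im (f x) * Re m))
      by (destruct l, m, (f x), (g x); simpl; ring).
    exact (is_derive_plus (V := R_NormedModule) _ _ _ _ _ (e _ _ _ _ f1 g2) (e _ _ _ _ f2 g1)).
Qed.

Lemma is_derive_RC_Cexp (f : R -> C) (x : R) (l : C) :
  is_derive_RC f x l -> is_derive_RC (fun u => Cexp (f u)) x (Cexp (f x) * l)%C.
Proof.
  intros hf.
  assert (f1 := is_derive_RC_Re _ _ _ hf). assert (f2 := is_derive_RC_Im _ _ _ hf).
  assert (hp : forall p q p' q', is_derive p x p' -> is_derive q x q' ->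
     is_derive (fun u => exp (p u) * cos (q u)) x
       (exp (p x) * cos (q x) * p' - exp (p x) * sin (q x) * q') /\
     is_derive (fun u => exp (p u) * sin (q u)) x
       (exp (p x) * cos (q x) * q' + exp (p x) * sin (q x) * p')).
  { intros p q p' q' hp hq.
    assert (e1 : Derive (fun u => p u) x = p') by exact (is_derive_unique _ _ _ hp).
    assert (e2 : Derive (fun u => q u) x = q') by exact (is_derive_unique _ _ _ hq).
    split; auto_derive; (repeat split; try (eexists; eassumption)) ||
     (rewrite e1, e2; ring). }
  destruct (hp _ _ _ _ f1 f2) as [h1 h2].
  apply is_derive_RC_components; [exact h1 | exact h2].
Qed.

Lemma is_derive_RC_affine (f : R -> C) (a b x : R) (l : C) :
  is_derive_RC f (a * x + b) l ->
  is_derive_RC (fun u => f (a * u + b)) x (RtoC a * l)%C.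
Proof.
  intros h.
  assert (ha : is_derive (fun u => a * u + b) x a) by (auto_derive; [exact I | ring]).
  apply (is_derive_RC_eq _ _ _ _ (is_derive_comp (V := C_R_NormedModule) f _ x l a h ha)).
  destruct l. unfold scal; simpl. unfold prod_scal, scal, Cmult; simpl. unfold mult; simpl.
  f_equal; ring.
Qed.

Lemma Cexp_plus (z w : C) : Cexp (z + w) = (Cexp z * Cexp w)%C.
Proof.
  destruct z as [a b], w as [c d]. unfold Cexp, Cmult, Re, Im; simpl.
  rewrite exp_plus, cos_plus, sin_plus. f_equal; ring.
Qed.

Lemma Cexp_0 : Cexp (RtoC 0) = RtoC 1.
Proof.
  unfold Cexp, RtoC; simpl. rewrite exp_0, cos_0, sin_0. f_equal; ring.
Qed.

Lemma Cexp_opp_r (z : C) : (Cexp z * Cexp (- z) = RtoC 1)%C.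
Proof. rewrite <- Cexp_plus, <- Cexp_0. f_equal. ring. Qed.

(** Lambda' = 2 z Lambda - 2 / sqrt pi: the Gaussian produced by the error
    function cancels the factor exp(z^2). *)
Lemma is_derive_Lambda (f : R -> C) (x : R) (l : C) :
  is_derive_RC f x l ->
  is_derive_RC (fun u => Lambda (f u)) x
    ((RtoC 2 * f x * Lambda (f x) - RtoC (2 / sqrt PI)) * l)%C.
Proof.
  intros h. unfold Lambda, Cminus.
  eapply is_derive_RC_eq.
  { apply is_derive_RC_mult.
    - apply is_derive_RC_Cexp, is_derive_RC_mult; exact h.
    - apply is_derive_RC_plus; [apply is_derive_RC_const|].
      apply is_derive_RC_opp, is_derive_Cerf, h. }
  cbn beta.
  transitivity ((RtoC 2 * f x * (Cexp (f x * f x) * (RtoC 1 + - Cerf (f x)))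
    + - (RtoC (2 / sqrt PI) * (Cexp (f x * f x) * Cexp (- (f x * f x))))) * l)%C; [ring|].
  rewrite Cexp_opp_r. ring.
Qed.

(** * The branch of the square root of i t *)

Lemma sqrt_i_sqr (t : R) : 0 <= t -> (sqrt_i t * sqrt_i t = Ci * RtoC t)%C.
Proof.
  intros ht. unfold sqrt_i, Cexp, Ci, Cmult, RtoC, Re, Im; simpl.
  replace ((0 * (PI / 4) - 1 * 0)) with 0 by ring.
  replace ((0 * 0 + 1 * (PI / 4))) with (PI / 4) by ring.
  rewrite exp_0, cos_PI4, sin_PI4.
  assert (h2 : sqrt 2 * sqrt 2 = 2) by (apply sqrt_sqrt; lra).
  assert (h2' : sqrt 2 <> 0) by (intro e; rewrite e in h2; lra).
  f_equal.
  - field; auto.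
  - transitivity (2 * (sqrt t * sqrt t) / (sqrt 2 * sqrt 2)); [field; auto|].
    rewrite h2, sqrt_sqrt by exact ht. field.
Qed.

Lemma sqrt_i_neq_0 (t : R) : 0 < t -> sqrt_i t <> RtoC 0.
Proof.
  intros ht e. assert (h := sqrt_i_sqr t (Rlt_le _ _ ht)).
  rewrite e in h. apply (f_equal snd) in h. simpl in h. lra.
Qed.

Lemma sqrt_i_scal (a t : R) : 0 <= a -> 0 <= t ->
  sqrt_i (a * t) = (RtoC (sqrt a) * sqrt_i t)%C.
Proof.
  intros ha ht. unfold sqrt_i. rewrite sqrt_mult by assumption. rewrite RtoC_mult. ring.
Qed.

Lemma RtoC_neq_0 (a : R) : a <> 0 -> RtoC a <> RtoC 0.
Proof. intros h e. apply h. now apply RtoC_inj. Qed.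

Lemma Ci_sqr : (Ci * Ci = - RtoC 1)%C.
Proof. unfold Ci, Cmult, Copp, RtoC; simpl. f_equal; ring. Qed.

Lemma Ci_neq_0 : Ci <> RtoC 0.
Proof. intros e. apply (f_equal snd) in e. simpl in e. lra. Qed.

Lemma is_derive_sqrt_i (t : R) : 0 < t ->
  is_derive_RC sqrt_i t (sqrt_i t / (RtoC 2 * RtoC t))%C.
Proof.
  intros ht. unfold sqrt_i.
  eapply is_derive_RC_eq.
  { apply is_derive_RC_mult; [apply is_derive_RC_const|].
    apply (is_derive_RC_RtoC sqrt t (sqrt t / (2 * t))).
    auto_derive; [exact ht|].
    rewrite <- (sqrt_sqrt t) at 3 by lra.
    field. intro e. assert (h := sqrt_lt_R0 _ ht). lra. }
  cbn beta. rewrite (RtoC_div (sqrt t)), RtoC_mult by lra.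
  unfold Cdiv. ring.
Qed.

Lemma is_derive_RC_inv (f : R -> C) (x : R) (l : C) :
  f x <> RtoC 0 -> is_derive_RC f x l ->
  is_derive_RC (fun u => (/ f u)%C) x (- l / (f x * f x))%C.
Proof.
  intros h0 hf.
  assert (hp : forall p q p' q', is_derive p x p' -> is_derive q x q' ->
     p x ^ 2 + q x ^ 2 <> 0 ->
     is_derive (fun u => p u / (p u ^ 2 + q u ^ 2)) x
       ((p' * (q x ^ 2 - p x ^ 2) - 2 * p x * q x * q') / (p x ^ 2 + q x ^ 2) ^ 2) /\
     is_derive (fun u => - q u / (p u ^ 2 + q u ^ 2)) x
       ((q' * (q x ^ 2 - p x ^ 2) + 2 * p x * q x * p') / (p x ^ 2 + q x ^ 2) ^ 2)).
  { intros p q p' q' hp hq hn.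
    assert (e1 : Derive (fun u => p u) x = p') by exact (is_derive_unique _ _ _ hp).
    assert (e2 : Derive (fun u => q u) x = q') by exact (is_derive_unique _ _ _ hq).
    split; (auto_derive; [repeat split; try (eexists; eassumption); exact hn|]);
    rewrite e1, e2; field; exact hn. }
  assert (h : Re (f x) ^ 2 + Im (f x) ^ 2 <> 0).
  { intros e. apply h0. destruct (f x) as [a b]; simpl in *.
    assert (a = 0) by nra. assert (b = 0) by nra. subst. reflexivity. }
  destruct (hp _ _ _ _ (is_derive_RC_Re _ _ _ hf) (is_derive_RC_Im _ _ _ hf) h)
    as [h1 h2].
  apply (is_derive_RC_eq _ _ (_, _) _ (is_derive_RC_components (fun u => (/ f u)%C) _ (_, _) h1 h2)).
  clear - h. destruct l as [l m], (f x) as [a b].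
  unfold Cdiv, Cinv, Cmult, Copp, Re, Im, fst, snd in *.
  replace ((a * a - b * b) ^ 2 + (a * b + b * a) ^ 2) with ((a ^ 2 + b ^ 2) ^ 2) by ring.
  f_equal; field; exact h.
Qed.

(** * The heat kernel and the boundary layer *)

Lemma RtoC_2_neq_0 : RtoC 2 <> RtoC 0.
Proof. apply RtoC_neq_0; lra. Qed.

Definition gaussian (t d : R) : C :=
  Cexp (- (RtoC (d ^ 2) / (RtoC 4 * Ci * RtoC t)))%C.

(** The heat kernel at imaginary time, that is, the free propagator. *)
Definition heat (t d : R) : C :=
  (RtoC 1 / (RtoC 2 * sqrt_i (PI * t)) * gaussian t d)%C.

Definition heat_d (t d : R) : C :=
  (- (RtoC d / (RtoC 2 * Ci * RtoC t)) * heat t d)%C.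

(** The wave that a point interaction of strength [w] adds to the propagator;
    [r] is the length of the path from the source to the observer through the
    origin. *)
Definition layer (w t r : R) : C :=
  (Lambda (RtoC r / (RtoC 2 * sqrt_i t) + RtoC w * sqrt_i t) * gaussian t r)%C.

Lemma is_derive_RC_scal (f : R -> C) (c : C) (x : R) (l : C) :
  is_derive_RC f x l -> is_derive_RC (fun u => (c * f u)%C) x (c * l)%C.
Proof.
  intros h. eapply is_derive_RC_eq.
  - apply is_derive_RC_mult; [apply is_derive_RC_const | exact h].
  - cbn beta. ring.
Qed.

Lemma is_derive_gaussian_d (t d : R) : 0 < t ->
  is_derive_RC (gaussian t) d (- (RtoC d / (RtoC 2 * Ci * RtoC t)) * gaussian t d)%C.
Proof.
  intros ht. assert (h0 := RtoC_neq_0 t ltac:(lra)).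
  unfold gaussian. eapply is_derive_RC_eq.
  { apply is_derive_RC_Cexp, is_derive_RC_opp, is_derive_RC_mult; [|apply is_derive_RC_const].
    apply (is_derive_RC_RtoC (fun d => d ^ 2) d (2 * d)). auto_derive; [exact I|ring]. }
  cbn beta. rewrite RtoC_mult. field. split; [exact h0|exact Ci_neq_0].
Qed.

Lemma is_derive_gaussian_t (t d : R) : 0 < t ->
  is_derive_RC (fun t => gaussian t d) t
    (RtoC (d ^ 2) / (RtoC 4 * Ci * RtoC t * RtoC t) * gaussian t d)%C.
Proof.
  intros ht. assert (h0 := RtoC_neq_0 t ltac:(lra)).
  unfold gaussian. eapply is_derive_RC_eq.
  { apply is_derive_RC_Cexp, is_derive_RC_opp, is_derive_RC_scal.
    apply (is_derive_RC_inv (fun t => RtoC 4 * Ci * RtoC t)%C).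
    2: apply is_derive_RC_scal, (is_derive_RC_RtoC (fun t => t) t 1); auto_derive; [exact I|ring].
    apply Cmult_neq_0; [apply Cmult_neq_0; [apply RtoC_neq_0; lra | exact Ci_neq_0]|exact h0]. }
  cbn beta. field. split; [exact h0|exact Ci_neq_0].
Qed.

Lemma is_derive_heat_d (t d : R) : 0 < t -> is_derive_RC (heat t) d (heat_d t d).
Proof.
  intros ht. eapply is_derive_RC_eq.
  { apply is_derive_RC_scal, is_derive_gaussian_d, ht. }
  unfold heat_d, heat. ring.
Qed.

Lemma is_derive_heat_dd (t d : R) : 0 < t ->
  is_derive_RC (heat_d t) d
    (- (RtoC 1 / (RtoC 2 * Ci * RtoC t)) * heat t d
     - RtoC d / (RtoC 2 * Ci * RtoC t) * heat_d t d)%C.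
Proof.
  intros ht. eapply is_derive_RC_eq.
  { apply is_derive_RC_mult; [|apply is_derive_heat_d, ht].
    apply is_derive_RC_opp, is_derive_RC_mult; [|apply is_derive_RC_const].
    apply (is_derive_RC_RtoC (fun d => d) d 1). auto_derive; [exact I|ring]. }
  cbn beta. unfold Cdiv. ring.
Qed.

Lemma sqrt_PI_neq_0 : sqrt PI <> 0.
Proof. assert (h := sqrt_lt_R0 _ PI_RGT_0). lra. Qed.

Lemma heat_eq (t d : R) : 0 < t ->
  heat t d = (RtoC 1 / (RtoC 2 * RtoC (sqrt PI) * sqrt_i t) * gaussian t d)%C.
Proof.
  intros ht. unfold heat. rewrite sqrt_i_scal; [|left; apply PI_RGT_0|lra].
  f_equal. f_equal. ring.
Qed.

Lemma is_derive_RC_ext_pos (f g : R -> C) (x : R) (l : C) :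
  0 < x -> (forall u, 0 < u -> f u = g u) -> is_derive_RC f x l -> is_derive_RC g x l.
Proof.
  intros hx e. apply is_derive_ext_loc.
  exists (mkposreal x hx). intros u hu. apply e.
  apply Rabs_def2 in hu. unfold minus, plus, opp in hu; simpl in hu. lra.
Qed.

Lemma is_derive_heat_t (t d : R) : 0 < t ->
  is_derive_RC (fun t => heat t d) t
    ((RtoC (d ^ 2) / (RtoC 4 * Ci * RtoC t * RtoC t) - RtoC 1 / (RtoC 2 * RtoC t)) * heat t d)%C.
Proof.
  intros ht. assert (h0 := RtoC_neq_0 t ltac:(lra)).
  assert (hk := sqrt_i_neq_0 t ht).
  assert (hpi := RtoC_neq_0 _ sqrt_PI_neq_0).
  apply is_derive_RC_ext_pos with (2 := fun u hu => eq_sym (heat_eq u d hu)); [exact ht|].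
  rewrite heat_eq by exact ht.
  eapply is_derive_RC_eq.
  { apply is_derive_RC_mult; [|apply is_derive_gaussian_t, ht].
    apply is_derive_RC_scal, is_derive_RC_inv.
    2: apply is_derive_RC_scal, is_derive_sqrt_i, ht.
    auto using Cmult_neq_0, RtoC_2_neq_0. }
  cbn beta. field. repeat split; auto using Ci_neq_0.
Qed.

(** The gradient of the Gaussian cancels the part r / (2 sqrt (i t)) of the
    argument of Lambda, since that part squares to minus the exponent.  The layer
    thus solves a Robin equation with the heat kernel as source, which lets
    it satisfy a boundary condition up to a multiple of [heat]. *)
Lemma is_derive_layer_r (w t r : R) : 0 < t ->
  is_derive_RC (layer w t) r (RtoC w * layer w t r - RtoC 2 * heat t r)%C.
Proof.
  intros ht. assert (h0 := RtoC_neq_0 t ltac:(lra)).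
  assert (hk := sqrt_i_neq_0 t ht).
  assert (hk2 := sqrt_i_sqr t (Rlt_le _ _ ht)).
  assert (hpi := RtoC_neq_0 _ sqrt_PI_neq_0).
  rewrite heat_eq by exact ht. unfold layer.
  eapply is_derive_RC_eq.
  { apply is_derive_RC_mult; [|apply is_derive_gaussian_d, ht].
    apply is_derive_Lambda, is_derive_RC_plus; [|apply is_derive_RC_const].
    apply is_derive_RC_mult; [|apply is_derive_RC_const].
    apply (is_derive_RC_RtoC (fun d => d) r 1). auto_derive; [exact I|ring]. }
  cbn beta.
  rewrite RtoC_div by exact sqrt_PI_neq_0.
  replace (RtoC 2 * Ci * RtoC t)%C with (RtoC 2 * (sqrt_i t * sqrt_i t))%C by (rewrite hk2; ring).
  field. auto.
Qed.

Lemma is_derive_layer_t (w t r : R) : 0 < t ->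
  is_derive_RC (fun t => layer w t r) t
    (Ci * RtoC w * RtoC w * layer w t r - RtoC 2 * Ci * RtoC w * heat t r
     + RtoC r / RtoC t * heat t r)%C.
Proof.
  intros ht. assert (h0 := RtoC_neq_0 t ltac:(lra)).
  assert (hk := sqrt_i_neq_0 t ht).
  assert (hk2 := sqrt_i_sqr t (Rlt_le _ _ ht)).
  assert (hpi := RtoC_neq_0 _ sqrt_PI_neq_0).
  rewrite heat_eq by exact ht. unfold layer.
  eapply is_derive_RC_eq.
  { apply is_derive_RC_mult; [|apply is_derive_gaussian_t, ht].
    apply is_derive_Lambda, is_derive_RC_plus.
    - apply is_derive_RC_scal, is_derive_RC_inv.
      2: apply is_derive_RC_scal, is_derive_sqrt_i, ht.
      auto using Cmult_neq_0, RtoC_2_neq_0.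
    - apply is_derive_RC_scal, is_derive_sqrt_i, ht. }
  cbn beta.
  rewrite RtoC_div by exact sqrt_PI_neq_0. rewrite (RtoC_pow r 2).
  replace (RtoC t) with (sqrt_i t * sqrt_i t / Ci)%C
    by (rewrite hk2; field; exact Ci_neq_0).
  field. auto using Ci_neq_0.
Qed.

(** The time derivative is written with the right-hand side that appears in
    [is_derive_heat_dd], up to sign. *)
Lemma heat_time_derivative (t d : R) : 0 < t ->
  exists l, is_derive_RC (fun t => heat t d) t l /\
    (Ci * l = RtoC 1 / (RtoC 2 * Ci * RtoC t) * heat t d
     + RtoC d / (RtoC 2 * Ci * RtoC t) * heat_d t d)%C.
Proof.
  intros ht. assert (h0 := RtoC_neq_0 t ltac:(lra)).
  eexists; split; [apply is_derive_heat_t, ht|].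
  unfold heat_d. rewrite (RtoC_pow d 2).
  assert (hi : (RtoC 1 / Ci = - Ci)%C).
  { replace (RtoC 1) with (- (Ci * Ci))%C by (rewrite Ci_sqr; ring). field. exact Ci_neq_0. }
  transitivity (RtoC 1 / Ci * (RtoC 1 / (RtoC 2 * RtoC t)) * heat t d
    + RtoC d ^ 2 / (RtoC 4 * RtoC t * RtoC t) * heat t d)%C.
  - rewrite hi. field. split; auto using Ci_neq_0.
  - replace (RtoC d / (RtoC 2 * Ci * RtoC t)
      * (- (RtoC d / (RtoC 2 * Ci * RtoC t)) * heat t d))%C
      with (- (RtoC d ^ 2 / (RtoC 4 * (Ci * Ci) * RtoC t * RtoC t) * heat t d))%C
      by (field; auto using Ci_neq_0).
    rewrite Ci_sqr. field. auto using Ci_neq_0.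
Qed.

(** * Solutions of the free Schroedinger equation *)

(** The equation is kept together with the space derivative [ux], since both
    the equation and the boundary condition refer to it. *)
Definition schrodinger_solution (u ux : R -> R -> C) : Prop :=
  forall t x, 0 < t ->
    is_derive_RC (u t) x (ux t x) /\
    exists ut uxx, is_derive_RC (fun t => u t x) t ut /\
      is_derive_RC (ux t) x uxx /\ (Ci * ut = - uxx)%C.

Lemma schrodinger_plus (u ux v vx : R -> R -> C) :
  schrodinger_solution u ux -> schrodinger_solution v vx ->
  schrodinger_solution (fun t x => u t x + v t x)%C (fun t x => ux t x + vx t x)%C.
Proof.
  intros hu hv t x ht.
  destruct (hu t x ht) as [hu1 [ut [uxx [hu2 [hu3 hu4]]]]].
  destruct (hv t x ht) as [hv1 [vt [vxx [hv2 [hv3 hv4]]]]].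
  split; [now apply is_derive_RC_plus|].
  exists (ut + vt)%C, (uxx + vxx)%C.
  split; [now apply is_derive_RC_plus|].
  split; [now apply is_derive_RC_plus|].
  transitivity (Ci * ut + Ci * vt)%C; [ring|]. rewrite hu4, hv4. ring.
Qed.

Lemma schrodinger_scal (c : C) (u ux : R -> R -> C) :
  schrodinger_solution u ux ->
  schrodinger_solution (fun t x => c * u t x)%C (fun t x => c * ux t x)%C.
Proof.
  intros hu t x ht.
  destruct (hu t x ht) as [hu1 [ut [uxx [hu2 [hu3 hu4]]]]].
  split; [now apply is_derive_RC_scal|].
  exists (c * ut)%C, (c * uxx)%C.
  split; [now apply is_derive_RC_scal|].
  split; [now apply is_derive_RC_scal|].
  transitivity (c * (Ci * ut))%C; [ring|]. rewrite hu4. ring.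
Qed.

Lemma schrodinger_isometry (s b : R) (u ux : R -> R -> C) :
  s * s = 1 -> schrodinger_solution u ux ->
  schrodinger_solution (fun t x => u t (s * x + b))
    (fun t x => RtoC s * ux t (s * x + b)%R)%C.
Proof.
  intros hs hu t x ht.
  destruct (hu t (s * x + b) ht) as [hu1 [ut [uxx [hu2 [hu3 hu4]]]]].
  split; [now apply is_derive_RC_affine|].
  exists ut, (RtoC s * (RtoC s * uxx))%C.
  split; [exact hu2|].
  split; [apply is_derive_RC_scal; now apply is_derive_RC_affine|].
  rewrite hu4, Cmult_assoc, <- RtoC_mult, hs. ring.
Qed.

Lemma schrodinger_heat : schrodinger_solution heat heat_d.
Proof.
  intros t x ht. split; [now apply is_derive_heat_d|].
  destruct (heat_time_derivative t x ht) as [l [hl e]].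
  exists l. eexists. split; [exact hl|].
  split; [now apply is_derive_heat_dd|]. rewrite e. ring.
Qed.

Lemma schrodinger_layer (w : R) :
  schrodinger_solution (layer w)
    (fun t r => RtoC w * layer w t r - RtoC 2 * heat t r)%C.
Proof.
  intros t r ht. split; [now apply is_derive_layer_r|].
  eexists; eexists. split; [now apply is_derive_layer_t|]. split.
  { apply is_derive_RC_plus.
    - apply is_derive_RC_scal, is_derive_layer_r, ht.
    - apply is_derive_RC_opp, is_derive_RC_scal, is_derive_heat_d, ht. }
  assert (h0 := RtoC_neq_0 t ltac:(lra)).
  unfold heat_d.
  transitivity ((Ci * Ci) * (RtoC w * RtoC w * layer w t r - RtoC 2 * RtoC w * heat t r)
     + Ci * Ci * (RtoC r / (Ci * RtoC t) * heat t r))%C;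
  [field | rewrite Ci_sqr; field]; auto using Ci_neq_0, RtoC_2_neq_0.
Qed.

(** * The Green's function on each half-line *)

(** On the half-line where [s * x > 0], [s] being 1 or -1, the coefficients are
    constant and |x| = s x.  The resulting formula is smooth on the whole line,
    across x = 0, so one-sided limits at 0 become values at 0. *)
Definition branch (c : coefficients) (s y t x : R) : C :=
  (mu_p c * layer (omega_p c) t (s * x + Rabs y)
   + mu_m c * layer (omega_m c) t (s * x + Rabs y)
   + mu_0 c * heat t (s * x + Rabs y)
   + heat t (1 * x + - y))%C.

Definition branch_x (c : coefficients) (s y t x : R) : C :=
  (mu_p c * (RtoC s * (RtoC (omega_p c) * layer (omega_p c) t (s * x + Rabs y)
                       - RtoC 2 * heat t (s * x + Rabs y)))
   + mu_m c * (RtoC s * (RtoC (omega_m c) * layer (omega_m c) t (s * x + Rabs y)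
                         - RtoC 2 * heat t (s * x + Rabs y)))
   + mu_0 c * (RtoC s * heat_d t (s * x + Rabs y))
   + RtoC 1 * heat_d t (1 * x + - y))%C.

Lemma schrodinger_branch (c : coefficients) (s y : R) :
  s * s = 1 -> schrodinger_solution (branch c s y) (branch_x c s y).
Proof.
  intros hs.
  apply (schrodinger_plus (fun t x => _) (fun t x => _)
    (fun t x => heat t (1 * x + - y)) (fun t x => RtoC 1 * heat_d t (1 * x + - y))%C).
  2: apply (schrodinger_isometry 1 (- y)); [ring | exact schrodinger_heat].
  apply schrodinger_plus; [apply schrodinger_plus|];
    apply schrodinger_scal.
  - apply (schrodinger_isometry s _ _ _ hs (schrodinger_layer (omega_p c))).
  - apply (schrodinger_isometry s _ _ _ hs (schrodinger_layer (omega_m c))).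
  - apply (schrodinger_isometry s _ _ _ hs schrodinger_heat).
Qed.

(** The coefficients depend on [x] only through its sign. *)
Lemma coef_scale (phi : R) (alpha beta : C) (s x y : R) : 0 < s ->
  coef phi alpha beta (s * x) y = coef phi alpha beta x y.
Proof.
  intros hs.
  assert (hpos : forall a, 0 < s * a <-> 0 < a) by (intros; split; intros; nra).
  assert (hT : forall a, Theta (s * a) = Theta a).
  { intros a. unfold Theta. specialize (hpos a).
    destruct (Rlt_dec 0 (s * a)), (Rlt_dec 0 a); tauto. }
  assert (he : eta alpha beta (s * x) y = eta alpha beta x y).
  { unfold eta. specialize (hpos x).
    destruct (Rlt_dec 0 (s * x)), (Rlt_dec 0 x); tauto. }
  assert (hs1 : sign (s * x * y) = sign (x * y)).
  { rewrite Rmult_assoc, sign_mult, (sign_eq_1 s hs). ring. }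
  unfold coef. rewrite he, hs1, Rmult_assoc, hT.
  replace (- (s * (x * y))) with (s * (- (x * y))) by ring. rewrite hT. reflexivity.
Qed.

Lemma Green_branch (phi : R) (alpha beta : C) (s t x y : R) :
  s * s = 1 -> 0 < s * x ->
  Green phi alpha beta t x y = branch (coef phi alpha beta s y) s y t x.
Proof.
  intros hs hx.
  assert (hc : coef phi alpha beta x y = coef phi alpha beta s y).
  { rewrite <- (coef_scale phi alpha beta (s * x) s y hx). f_equal.
    transitivity (s * s * x); [rewrite hs|]; ring. }
  assert (ha : Rabs x = s * x).
  { destruct (Rle_lt_dec 0 x); [rewrite Rabs_right|rewrite Rabs_left]; nra. }
  unfold Green, branch. rewrite hc, ha.
  replace (1 * x + - y) with (x - y) by ring.
  unfold layer, heat, gaussian. ring.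
Qed.

Lemma is_derive_RC_lim (f : R -> C) (l : C) : is_derive_RC f 0 l ->
  filterlim f (locally 0) (locally (f 0)).
Proof.
  intros h. apply (ex_derive_continuous (V := C_R_NormedModule) f 0).
  now exists l.
Qed.

Lemma lim_right0_ext (f g : R -> C) (l : C) :
  (forall x, 0 < x -> f x = g x) -> is_derive_RC f 0 l -> lim_right0 g (f 0).
Proof.
  intros e h.
  apply (filterlim_ext_loc f).
  - exists (mkposreal 1 Rlt_0_1). intros x _ hx. now apply e.
  - eapply filterlim_filter_le_1; [apply filter_le_within|].
    now apply (is_derive_RC_lim f l).
Qed.

Lemma lim_left0_ext (f g : R -> C) (l : C) :
  (forall x, x < 0 -> f x = g x) -> is_derive_RC f 0 l -> lim_left0 g (f 0).
Proof.
  intros e h.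
  apply (filterlim_ext_loc f).
  - exists (mkposreal 1 Rlt_0_1). intros x _ hx. now apply e.
  - eapply filterlim_filter_le_1; [apply filter_le_within|].
    now apply (is_derive_RC_lim f l).
Qed.

Lemma heat_opp (t d : R) : heat t (- d) = heat t d.
Proof. unfold heat, gaussian. now replace ((- d) ^ 2) with (d ^ 2) by ring. Qed.

Lemma heat_d_opp (t d : R) : heat_d t (- d) = (- heat_d t d)%C.
Proof. unfold heat_d. rewrite heat_opp, RtoC_opp. unfold Cdiv. ring. Qed.

Lemma heat_abs (t d : R) : heat t (Rabs d) = heat t d.
Proof. unfold Rabs. destruct (Rcase_abs d); [apply heat_opp | reflexivity]. Qed.

Lemma branch_0 (c : coefficients) (s y t : R) :
  branch c s y t 0 =
  (mu_p c * layer (omega_p c) t (Rabs y) + mu_m c * layer (omega_m c) t (Rabs y)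
   + (mu_0 c + RtoC 1) * heat t (Rabs y))%C.
Proof.
  unfold branch. rewrite !Rmult_0_r, !Rplus_0_l, heat_opp, <- (heat_abs t y). ring.
Qed.

(** Multiplication by [s] gives the derivative pointing away from the origin,
    which is the one that the jump condition uses on either side.  The direct
    wave travels towards the origin on one side only, hence the sign. *)
Lemma branch_x_0 (c : coefficients) (s y t : R) : s * s = 1 -> y <> 0 ->
  (RtoC s * branch_x c s y t 0 =
   mu_p c * RtoC (omega_p c) * layer (omega_p c) t (Rabs y)
   + mu_m c * RtoC (omega_m c) * layer (omega_m c) t (Rabs y)
   - RtoC 2 * (mu_p c + mu_m c) * heat t (Rabs y)
   + (mu_0 c - RtoC (sign (s * y))) * heat_d t (Rabs y))%C.
Proof.
  intros hs hy. unfold branch_x. rewrite !Rmult_0_r, !Rplus_0_l, heat_d_opp.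
  assert (e : (RtoC s * heat_d t y = RtoC (sign (s * y)) * heat_d t (Rabs y))%C).
  { rewrite sign_mult.
    replace (sign s) with s.
    2:{ destruct (Rle_lt_dec 0 s); [rewrite sign_eq_1|rewrite sign_eq_m1]; nra. }
    unfold Rabs. destruct (Rcase_abs y) as [h|h].
    - rewrite (sign_eq_m1 y h), heat_d_opp. replace (s * -1) with (- s) by ring.
      rewrite RtoC_opp. ring.
    - rewrite (sign_eq_1 y) by lra. now rewrite Rmult_1_r. }
  assert (hs' : (RtoC s * RtoC s = RtoC 1)%C) by now rewrite <- RtoC_mult, hs.
  transitivity ((RtoC s * RtoC s) * (mu_p c * RtoC (omega_p c) * layer (omega_p c) t (Rabs y)
   + mu_m c * RtoC (omega_m c) * layer (omega_m c) t (Rabs y)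
   - RtoC 2 * (mu_p c + mu_m c) * heat t (Rabs y)
   + mu_0 c * heat_d t (Rabs y)) - RtoC s * heat_d t y)%C; [ring|].
  rewrite e, hs'. ring.
Qed.

(** * The jump condition as a linear relation *)

(** (I - J) u = i (I + J) v in coordinates, where J is [e] times the matrix with
    rows (alpha, - conj beta) and (beta, conj alpha). *)
Definition jump (e alpha beta u1 u2 v1 v2 : C) : Prop :=
  (u1 - e * (alpha * u1 - Cconj beta * u2)
     = Ci * (v1 + e * (alpha * v1 - Cconj beta * v2)))%C /\
  (u2 - e * (beta * u1 + Cconj alpha * u2)
     = Ci * (v2 + e * (beta * v1 + Cconj alpha * v2)))%C.

Lemma jump_lin (e alpha beta c d u1 u2 v1 v2 u1' u2' v1' v2' : C) :
  jump e alpha beta u1 u2 v1 v2 -> jump e alpha beta u1' u2' v1' v2' ->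
  jump e alpha beta (c * u1 + d * u1') (c * u2 + d * u2')
    (c * v1 + d * v1') (c * v2 + d * v2').
Proof.
  intros [h1 h2] [h1' h2']. split.
  - transitivity (c * (u1 - e * (alpha * u1 - Cconj beta * u2))
       + d * (u1' - e * (alpha * u1' - Cconj beta * u2')))%C; [ring|].
    rewrite h1, h1'. ring.
  - transitivity (c * (u2 - e * (beta * u1 + Cconj alpha * u2))
       + d * (u2' - e * (beta * u1' + Cconj alpha * u2')))%C; [ring|].
    rewrite h2, h2'. ring.
Qed.

Lemma jump_matrix (phi : R) (alpha beta u1 u2 v1 v2 : C) :
  jump (Cexp (Ci * RtoC phi)) alpha beta u1 u2 v1 v2 ->
  Mmult (Mplus Mone (Mopp (Jmat phi alpha beta))) ([[u1], [u2]] : @matrix C 2 1) =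
  Mmult (Mscal Ci (Mplus Mone (Jmat phi alpha beta))) ([[v1], [v2]] : @matrix C 2 1).
Proof.
  intros [h1 h2]. unfold Jmat. set (e := Cexp _) in *.
  unfold Mmult, Mplus, Mopp, Mone, Mscal, mk_matrix, coeff_mat. simpl.
  rewrite !sum_Sn, !sum_O. simpl.
  unfold plus, mult, opp, one, zero; simpl.
  f_equal; [f_equal | f_equal; f_equal].
  - etransitivity; [|etransitivity; [exact h1|]]; ring.
  - etransitivity; [|etransitivity; [exact h2|]]; ring.
Qed.

Definition jump_eigen (e alpha beta l u1 u2 : C) : Prop :=
  (e * (alpha * u1 - Cconj beta * u2) = l * u1)%C /\
  (e * (beta * u1 + Cconj alpha * u2) = l * u2)%C.

(** On an eigenline, the relation becomes the scalar Robin condition with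
    parameter [w], the Cayley transform of the eigenvalue. *)
Lemma jump_of_eigen (e alpha beta l u1 u2 : C) (w : R) :
  jump_eigen e alpha beta l u1 u2 ->
  (RtoC 1 - l = Ci * RtoC w * (RtoC 1 + l))%C ->
  jump e alpha beta u1 u2 (RtoC w * u1) (RtoC w * u2).
Proof.
  intros [h1 h2] hl. split.
  - transitivity ((RtoC 1 - l) * u1)%C; [rewrite h1; ring|].
    rewrite hl. transitivity (Ci * RtoC w * (u1 + l * u1))%C; [ring|].
    rewrite <- h1. ring.
  - transitivity ((RtoC 1 - l) * u2)%C; [rewrite h2; ring|].
    rewrite hl. transitivity (Ci * RtoC w * (u2 + l * u2))%C; [ring|].
    rewrite <- h2. ring.
Qed.

(** For the eigenvalue -1 the matrix I + J vanishes on the eigenvector: only the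
    Dirichlet condition is left, and the normal derivatives are unconstrained
    along this line. *)
Lemma jump_kernel (e alpha beta u1 u2 : C) :
  jump_eigen e alpha beta (- RtoC 1) u1 u2 ->
  jump e alpha beta (RtoC 0) (RtoC 0) u1 u2.
Proof.
  intros [h1 h2]. split; [rewrite h1 | rewrite h2]; ring.
Qed.

(** Half the distance between the eigenvalues of J: these are
    e (Re alpha + i spread) and e (Re alpha - i spread). *)
Definition spread (alpha : C) : R := sqrt (1 - Re alpha ^ 2).

Lemma spread_sqr (alpha beta : C) : Cmod alpha ^ 2 + Cmod beta ^ 2 = 1 ->
  spread alpha ^ 2 = Im alpha ^ 2 + Re beta ^ 2 + Im beta ^ 2 /\
  spread alpha ^ 2 = 1 - Re alpha ^ 2.
Proof.
  unfold Cmod, spread. rewrite !pow2_sqrt by nra. intros h.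
  destruct alpha, beta; unfold Re, Im; simpl in *. rewrite !Rmult_1_r, sqrt_sqrt by nra.
  nra.
Qed.

(** The unnormalized coefficient.  For fixed [y], its values at x > 0 and x < 0
    form a column of - H, where J = e (Re alpha + i H) and H is Hermitian,
    traceless, with square equal to [spread] squared times I; for y > 0 this is
    the first column and for y < 0 the second one. *)
Definition eta_num (alpha beta : C) (x y : R) : C :=
  if Rlt_dec 0 x then
    if Rlt_dec 0 y then RtoC (- Im alpha) else (- Ci * Cconj beta)%C
  else
    if Rlt_dec 0 y then (Ci * beta)%C else RtoC (Im alpha).

(** The normalizing factor [k] is 1 / spread, or 0 when H = 0.  The identities
    cover both cases, so that later arguments need not separate them. *)
Lemma eta_scaled (alpha beta : C) : Cmod alpha ^ 2 + Cmod beta ^ 2 = 1 ->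
  exists k : R,
    (forall x y, eta alpha beta x y = RtoC k * eta_num alpha beta x y)%C /\
    k * (Im alpha ^ 2 + Re beta ^ 2 + Im beta ^ 2) = spread alpha /\
    spread alpha * k * Im alpha = Im alpha /\
    spread alpha * k * Re beta = Re beta /\
    spread alpha * k * Im beta = Im beta.
Proof.
  intros hab. destruct (spread_sqr _ _ hab) as [h1 h2].
  destruct (Req_EM_T (Rabs (Re alpha)) 1) as [e|e].
  - assert (h : Re alpha ^ 2 = 1) by (rewrite <- pow2_abs, e; ring).
    assert (spread alpha = 0) by nra. assert (Im alpha = 0) by nra.
    assert (Re beta = 0) by nra. assert (Im beta = 0) by nra.
    exists 0. split.
    + intros x y. unfold eta. destruct (Req_EM_T _ _); [ring | tauto].
    + repeat split; nra.
  - assert (h : spread alpha <> 0).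
    { intros e'. rewrite e' in h2. apply e.
      assert (h : Re alpha ^ 2 = 1) by nra.
      rewrite <- pow2_abs in h. assert (0 <= Rabs (Re alpha)) by apply Rabs_pos. nra. }
    exists (1 / spread alpha). split.
    + intros x y. unfold eta. destruct (Req_EM_T _ _); [tauto | reflexivity].
    + rewrite <- h1. repeat split; field; exact h.
Qed.

(** For [ep] = 1 or -1, the vector is a column of I - ep H / spread, twice the
    projection onto the eigenspace of H for - ep spread (for H = 0, it is a
    column of I). *)
Lemma eta_eigen (phi : R) (alpha beta : C) (y ep : R) :
  Cmod alpha ^ 2 + Cmod beta ^ 2 = 1 -> y <> 0 -> ep = 1 \/ ep = -1 ->
  jump_eigen (Cexp (Ci * RtoC phi)) alpha beta
    (Cexp (Ci * RtoC phi) * (RtoC (Re alpha) - Ci * RtoC (ep * spread alpha)))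
    (RtoC (Theta (1 * y)) + RtoC ep * eta alpha beta 1 y)
    (RtoC (Theta (-1 * y)) + RtoC ep * eta alpha beta (-1) y).
Proof.
  intros hab hy hep.
  destruct (eta_scaled _ _ hab) as [k [hk [k0 [k1 [k2 k3]]]]].
  rewrite !hk. unfold eta_num, Theta.
  destruct (Rlt_dec 0 1); [|lra]. destruct (Rlt_dec 0 (-1)); [lra|].
  revert k0 k1 k2 k3. generalize (spread alpha). intros S k0 k1 k2 k3.
  destruct alpha as [a b], beta as [p q]; unfold Re, Im, fst, snd in *.
  destruct (Rlt_dec 0 y);
  [ destruct (Rlt_dec 0 (1 * y)); [|lra]; destruct (Rlt_dec 0 (-1 * y)); [lra|]
  | destruct (Rlt_dec 0 (1 * y)); [lra|]; destruct (Rlt_dec 0 (-1 * y)); [|lra]];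
  split; rewrite <- Cmult_assoc; f_equal;
  unfold Cmult, Cminus, Cplus, Copp, Cconj, RtoC, Ci; simpl;
  destruct hep as [-> | ->]; f_equal; lra.
Qed.

Lemma jump_congr (e alpha beta u1 u2 v1 v2 u1' u2' v1' v2' : C) :
  jump e alpha beta u1 u2 v1 v2 ->
  u1 = u1' -> u2 = u2' -> v1 = v1' -> v2 = v2' ->
  jump e alpha beta u1' u2' v1' v2'.
Proof. now intros h <- <- <- <-. Qed.

Lemma Cexp_Ci (phi : R) : Cexp (Ci * RtoC phi) = (cos phi, sin phi).
Proof.
  unfold Cexp, Ci, Cmult, RtoC; simpl.
  replace (0 * phi - 1 * 0) with 0 by ring. replace (0 * 0 + 1 * phi) with phi by ring.
  rewrite exp_0. f_equal; ring.
Qed.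

(** omega is the Cayley transform of the eigenvalue.  Multiplied by
    cos phi + a, the real and the imaginary part of the claim follow from
    the two Pythagorean relations. *)
Lemma eigenvalue_generic (phi a S ep : R) :
  S ^ 2 = 1 - a ^ 2 -> ep = 1 \/ ep = -1 -> cos phi + a <> 0 ->
  let l := (Cexp (Ci * RtoC phi) * (RtoC a - Ci * RtoC (ep * S)))%C in
  (RtoC 1 - l = Ci * RtoC ((- sin phi + ep * S) / (cos phi + a)) * (RtoC 1 + l))%C.
Proof.
  intros hS hep hd l. unfold l. rewrite Cexp_Ci.
  assert (hsc := sin2_cos2 phi). unfold Rsqr in hsc.
  set (w := _ / _).
  assert (hw : w * (cos phi + a) = - sin phi + ep * S) by (unfold w; field; exact hd).
  unfold Cmult, Cminus, Cplus, Copp, RtoC, Ci; simpl.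
  clearbody w. revert hd hw hsc. generalize (cos phi) (sin phi). intros c s hd hw hsc.
  assert (hz : forall X Y, (c + a) * X = (c + a) * Y -> X = Y)
    by (intros X Y h; exact (Rmult_eq_reg_l _ _ _ h hd)).
  assert (hep2 : ep * ep = 1) by (destruct hep as [-> | ->]; ring).
  f_equal; apply hz.
  - transitivity (- (w * (c + a)) * (s * a - c * (ep * S))); [|ring].
    rewrite hw.
    transitivity (c * (1 - a ^ 2) + a * (1 - c * c) - ep * s * S * c - ep * s * S * a); [ring|].
    replace (1 - c * c) with (s * s) by lra. rewrite <- hS.
    transitivity (c * (ep * ep) * S ^ 2 + a * (s * s) - ep * s * S * c - ep * s * S * a);
      [rewrite hep2; ring | ring].
  - transitivity ((w * (c + a)) * (1 + (c * a + s * (ep * S)))); [|ring].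
    rewrite hw.
    transitivity (- s * (1 - (1 - a ^ 2)) + ep * S * (c * c) - s * c * a + ep * S * c * a); [ring|].
    replace (c * c) with (1 - s * s) by lra. rewrite <- hS.
    transitivity (- s * (1 - ep * ep * S ^ 2) + ep * S * (1 - s * s) - s * c * a + ep * S * c * a);
      [rewrite hep2; ring | ring].
Qed.

Lemma eigenvalue_kernel (phi : R) :
  (Cexp (Ci * RtoC phi) * (RtoC (- cos phi) - Ci * RtoC (-1 * sin phi)) = - RtoC 1)%C.
Proof.
  rewrite Cexp_Ci. assert (hsc := sin2_cos2 phi). unfold Rsqr in hsc.
  unfold Cmult, Cminus, Cplus, Copp, RtoC, Ci; simpl. f_equal; lra.
Qed.

Lemma eigenvalue_cot (phi : R) : sin phi <> 0 ->
  let l := (Cexp (Ci * RtoC phi) * (RtoC (- cos phi) - Ci * RtoC (1 * sin phi)))%C in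
  (RtoC 1 - l = Ci * RtoC (cos phi / sin phi) * (RtoC 1 + l))%C.
Proof.
  intros h0 l. unfold l.
  rewrite Cexp_Ci. assert (hsc := sin2_cos2 phi). unfold Rsqr in hsc.
  unfold Cmult, Cminus, Cplus, Copp, RtoC, Ci; simpl.
  revert h0 hsc. generalize (cos phi) (sin phi). intros c s h0 hsc.
  f_equal.
  - transitivity (2 * (c * c)).
    + replace 1 with (s * s + c * c) at 1 by exact hsc. ring.
    + field. exact h0.
  - transitivity (c / s * (1 + s * s - c * c)).
    + replace (1 + s * s - c * c) with (2 * (s * s)) by lra. field. exact h0.
    + field. exact h0.
Qed.

Lemma sign_Theta (z : R) : z <> 0 ->
  sign z = Theta z - Theta (- z) /\ Theta z + Theta (- z) = 1.
Proof.
  intros hz. unfold Theta. destruct (Rlt_dec 0 z).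
  - rewrite sign_eq_1 by assumption. destruct (Rlt_dec 0 (- z)); lra.
  - rewrite sign_eq_m1 by lra. destruct (Rlt_dec 0 (- z)); lra.
Qed.

(** The linear relations behind the jump condition, one for each of the
    functions of t in the boundary values: the two layers, the heat kernel and
    its derivative.  The residues mu of the layers are multiples of the
    eigenvectors, and the sum of the sources that they emit is compensated by
    the value mu_0 + 1 of the heat kernel. *)
Lemma coef_jump (phi : R) (alpha beta : C) (y : R) :
  0 <= phi < PI -> Cmod alpha ^ 2 + Cmod beta ^ 2 = 1 -> y <> 0 ->
  let cp := coef phi alpha beta 1 y in
  let cm := coef phi alpha beta (-1) y in
  let jmp := jump (Cexp (Ci * RtoC phi)) alpha beta in
  omega_p cp = omega_p cm /\ omega_m cp = omega_m cm /\
  jmp (mu_p cp) (mu_p cm)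
    (mu_p cp * RtoC (omega_p cp))%C (mu_p cm * RtoC (omega_p cm))%C /\
  jmp (mu_m cp) (mu_m cm)
    (mu_m cp * RtoC (omega_m cp))%C (mu_m cm * RtoC (omega_m cm))%C /\
  jmp (mu_0 cp + RtoC 1)%C (mu_0 cm + RtoC 1)%C
    (- (RtoC 2 * (mu_p cp + mu_m cp)))%C (- (RtoC 2 * (mu_p cm + mu_m cm)))%C /\
  jmp (RtoC 0) (RtoC 0)
    (mu_0 cp - RtoC (sign (1 * y)))%C (mu_0 cm - RtoC (sign (-1 * y)))%C.
Proof.
  intros hphi hab hy cp cm jmp.
  destruct (spread_sqr _ _ hab) as [hH hS].
  assert (Ep := eta_eigen phi alpha beta y 1 hab hy (or_introl eq_refl)).
  assert (Em := eta_eigen phi alpha beta y (-1) hab hy (or_intror eq_refl)).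
  destruct (sign_Theta (1 * y)) as [s1 t1]; [lra|].
  destruct (sign_Theta (-1 * y)) as [s2 t2]; [lra|].
  apply (f_equal RtoC) in s1, s2, t1, t2.
  rewrite RtoC_minus in s1, s2. rewrite RtoC_plus in t1, t2.
  assert (q1 : RtoC (Theta (- (1 * y))) = (RtoC 1 - RtoC (Theta (1 * y)))%C)
    by (rewrite <- t1; ring).
  assert (q2 : RtoC (Theta (- (-1 * y))) = (RtoC 1 - RtoC (Theta (-1 * y)))%C)
    by (rewrite <- t2; ring).
  assert (j0 : jmp (RtoC 0) (RtoC 0) (RtoC 0) (RtoC 0)) by (split; ring).
  unfold cp, cm, coef.
  destruct (Req_EM_T (Re alpha) (- cos phi)) as [e1|e1];
    [destruct (Req_EM_T (Re alpha) (-1)) as [e2|e2]|]; cbn [omega_p omega_m mu_p mu_m mu_0].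
  - (* J = - I, so every vector is an eigenvector for -1. *)
    split; [reflexivity|]. split; [reflexivity|].
    assert (hE : jump_eigen (Cexp (Ci * RtoC phi)) alpha beta (- RtoC 1)
      (RtoC (-1) - RtoC (sign (1 * y))) (RtoC (-1) - RtoC (sign (-1 * y)))).
    { assert (h := sin2_cos2 phi). unfold Rsqr in h.
      assert (hc : cos phi = 1) by lra. assert (hs : sin phi = 0) by nra.
      rewrite Cexp_Ci, hc, hs.
      destruct alpha as [a b], beta as [p q]; unfold Re, Im, fst, snd in *.
      assert (hb : b = 0) by nra. assert (hp : p = 0) by nra. assert (hq : q = 0) by nra.
      rewrite e2, hb, hp, hq.
      split; unfold Cmult, Cminus, Cplus, Copp, Cconj, RtoC; simpl; f_equal; ring. }
    split; [|split; [|split]].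
    + apply (jump_congr _ _ _ _ _ _ _ _ _ _ _ j0); ring.
    + apply (jump_congr _ _ _ _ _ _ _ _ _ _ _ j0); ring.
    + apply (jump_congr _ _ _ _ _ _ _ _ _ _ _ j0); rewrite ?RtoC_opp; ring.
    + apply jump_kernel, hE.
  - assert (hs : 0 < sin phi).
    { apply sin_gt_0; [|lra]. destruct (proj1 hphi) as [h|h]; [exact h|].
      exfalso. apply e2. rewrite e1, <- h, cos_0. ring. }
    assert (hSs : spread alpha = sin phi).
    { assert (h := sin2_cos2 phi). unfold Rsqr in h.
      assert (0 <= spread alpha) by apply sqrt_pos. rewrite e1 in hS. nra. }
    (* One of the eigenvalues is -1; its eigenvector enters through mu_0. *)
    rewrite e1, hSs in Ep, Em. rewrite eigenvalue_kernel in Em.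
    assert (Jp := jump_of_eigen _ _ _ _ _ _ _ Ep (eigenvalue_cot phi ltac:(lra))).
    apply jump_kernel in Em.
    set (w := cos phi / sin phi) in *.
    split; [reflexivity|]. split; [reflexivity|].
    split; [|split; [|split]].
    + apply (jump_congr _ _ _ _ _ _ _ _ _ _ _
        (jump_lin _ _ _ (- RtoC (w / 2))%C (RtoC 0) _ _ _ _ _ _ _ _ Jp j0)); ring.
    + apply (jump_congr _ _ _ _ _ _ _ _ _ _ _ j0); ring.
    + rewrite RtoC_div by lra.
      apply (jump_congr _ _ _ _ _ _ _ _ _ _ _ Jp);
        rewrite ?q1, ?q2; try ring; field; apply RtoC_2_neq_0.
    + apply (jump_congr _ _ _ _ _ _ _ _ _ _ _
        (jump_lin _ _ _ (- RtoC 1)%C (RtoC 0) _ _ _ _ _ _ _ _ Em j0));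
        rewrite ?s1, ?s2, ?RtoC_opp; ring.
  - assert (hd : cos phi + Re alpha <> 0) by lra.
    assert (Jp := jump_of_eigen _ _ _ _ _ _ _ Ep
       (eigenvalue_generic phi _ _ 1 hS (or_introl eq_refl) hd)).
    assert (Jm := jump_of_eigen _ _ _ _ _ _ _ Em
       (eigenvalue_generic phi _ _ (-1) hS (or_intror eq_refl) hd)).
    change (sqrt (1 - Re alpha ^ 2)) with (spread alpha).
    replace (- sin phi + 1 * spread alpha) with (- sin phi + spread alpha) in Jp by ring.
    replace (- sin phi + -1 * spread alpha) with (- sin phi - spread alpha) in Jm by ring.
    set (wp := (- sin phi + spread alpha) / _) in *.
    set (wm := (- sin phi - spread alpha) / _) in *.
    split; [reflexivity|]. split; [reflexivity|].
    split; [|split; [|split]].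
    + apply (jump_congr _ _ _ _ _ _ _ _ _ _ _
        (jump_lin _ _ _ (- RtoC (wp / 2))%C (RtoC 0) _ _ _ _ _ _ _ _ Jp j0)); ring.
    + apply (jump_congr _ _ _ _ _ _ _ _ _ _ _
        (jump_lin _ _ _ (- RtoC (wm / 2))%C (RtoC 0) _ _ _ _ _ _ _ _ Jm j0));
        rewrite ?RtoC_opp; ring.
    + rewrite !RtoC_div by lra.
      apply (jump_congr _ _ _ _ _ _ _ _ _ _ _
        (jump_lin _ _ _ (RtoC 1) (RtoC 1) _ _ _ _ _ _ _ _ Jp Jm));
        rewrite ?s1, ?s2, ?q1, ?q2, ?RtoC_opp; try ring; field; apply RtoC_2_neq_0.
    + apply (jump_congr _ _ _ _ _ _ _ _ _ _ _ j0); ring.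
Qed.

Theorem theorem2p4
  (J : @matrix C 2 2) (phi : R) (alpha beta : C)
  (hJ : unitary J)
  (hphi : 0 <= phi < PI)
  (hab : Cmod alpha ^ 2 + Cmod beta ^ 2 = 1)
  (hJrep : J = Jmat phi alpha beta)
  (y : R) (hy : y <> 0) :
  exists Gx : R -> R -> C,
    (forall t x : R, 0 < t -> x <> 0 ->
       is_derive_RC (fun x' => Green phi alpha beta t x' y) x (Gx t x)) /\
    (forall t x : R, 0 < t -> x <> 0 ->
       exists Gt Gxx : C,
         is_derive_RC (fun t' => Green phi alpha beta t' x y) t Gt /\
         is_derive_RC (fun x' => Gx t x') x Gxx /\
         (Ci * Gt)%C = (- Gxx)%C) /\
    (forall t : R, 0 < t ->
       exists Gp Gm dGp dGm : C,
         lim_right0 (fun x => Green phi alpha beta t x y) Gp /\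
         lim_left0 (fun x => Green phi alpha beta t x y) Gm /\
         lim_right0 (fun x => Gx t x) dGp /\
         lim_left0 (fun x => Gx t x) dGm /\
         Mmult (Mplus Mone (Mopp J)) ([[Gp], [Gm]] : @matrix C 2 1) =
         Mmult (Mscal Ci (Mplus Mone J))
           ([[dGp], [(- dGm)%C]] : @matrix C 2 1)).
Proof.
  set (c s := coef phi alpha beta s y).
  assert (hG : forall s t x, s * s = 1 -> 0 < s * x ->
    Green phi alpha beta t x y = branch (c s) s y t x)
    by (intros; now apply Green_branch).
  assert (hsgn : forall s x, s * s = 1 -> 0 < s * x -> sign x = s).
  { intros s x hs hx. destruct (Rle_lt_dec 0 s).
    - rewrite sign_eq_1; nra.
    - rewrite sign_eq_m1; nra. }
  assert (hside : forall x, x <> 0 -> exists s, s * s = 1 /\ 0 < s * x).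
  { intros x hx. destruct (Rlt_dec 0 x); [exists 1 | exists (-1)]; lra. }
  assert (hnear : forall (s x : R) (f g : R -> C) (l : C), 0 < s * x ->
    (forall u, 0 < s * u -> f u = g u) ->
    is_derive_RC f x l -> is_derive_RC g x l).
  { intros s x f g l hx e. apply is_derive_ext_loc.
    assert (h : continuous (fun u => s * u) x).
    { apply (ex_derive_continuous (V := R_NormedModule)). auto_derive. exact I. }
    apply (filter_imp (fun u => 0 < s * u)); [exact e|].
    apply (h (fun v => 0 < v)). exact (open_gt 0 _ hx). }
  assert (hS : forall s, s * s = 1 ->
    schrodinger_solution (branch (c s) s y) (branch_x (c s) s y))
    by (intros; now apply schrodinger_branch).
  exists (fun t x => branch_x (c (sign x)) (sign x) y t x).
  split; [|split].
  - intros t x ht hx. destruct (hside x hx) as [s [hs hsx]].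
    rewrite (hsgn s x hs hsx).
    apply (hnear s x (branch (c s) s y t)); [exact hsx | | apply (hS s hs t x ht)].
    intros u hu. symmetry. now apply hG.
  - intros t x ht hx. destruct (hside x hx) as [s [hs hsx]].
    destruct (hS s hs t x ht) as [_ [Gt [Gxx [h1 [h2 h3]]]]].
    exists Gt, Gxx. split; [|split; [|exact h3]].
    + apply (is_derive_ext (V := C_R_NormedModule) (fun t => branch (c s) s y t x)); [|exact h1].
      intros t'. symmetry. now apply hG.
    + apply (hnear s x (branch_x (c s) s y t)); [exact hsx | | exact h2].
      intros u hu. now rewrite (hsgn s u hs hu).
  - intros t ht.
    destruct (hS 1 ltac:(lra) t 0 ht) as [dp [_ [dpp [_ [dpx _]]]]].
    destruct (hS (-1) ltac:(lra) t 0 ht) as [dm [_ [dmm [_ [dmx _]]]]].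
    exists (branch (c 1) 1 y t 0), (branch (c (-1)) (-1) y t 0),
      (branch_x (c 1) 1 y t 0), (branch_x (c (-1)) (-1) y t 0).
    split; [|split; [|split; [|split]]].
    + apply (lim_right0_ext _ _ _ (fun x hx => eq_sym (hG 1 t x ltac:(lra) ltac:(lra))) dp).
    + apply (lim_left0_ext _ _ _ (fun x hx => eq_sym (hG (-1) t x ltac:(lra) ltac:(lra))) dm).
    + eapply lim_right0_ext; [|exact dpx].
      intros x hx. now rewrite (hsgn 1 x) by lra.
    + eapply lim_left0_ext; [|exact dmx].
      intros x hx. now rewrite (hsgn (-1) x) by lra.
    + rewrite hJrep. apply jump_matrix.
      destruct (coef_jump phi alpha beta y hphi hab hy) as [ep [em [j1 [j2 [j3 j4]]]]].
      fold (c 1) (c (-1)) in ep, em, j1, j2, j3, j4.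
      assert (b1 := branch_x_0 (c 1) 1 y t ltac:(lra) hy).
      assert (b2 := branch_x_0 (c (-1)) (-1) y t ltac:(lra) hy).
      rewrite !branch_0.
      apply (jump_congr _ _ _ _ _ _ _ _ _ _ _
       (jump_lin _ _ _ (RtoC 1) (RtoC 1) _ _ _ _ _ _ _ _
        (jump_lin _ _ _ (layer (omega_p (c 1)) t (Rabs y))
          (layer (omega_m (c 1)) t (Rabs y)) _ _ _ _ _ _ _ _ j1 j2)
        (jump_lin _ _ _ (heat t (Rabs y)) (heat_d t (Rabs y)) _ _ _ _ _ _ _ _ j3 j4))).
      * ring.
      * rewrite ep, em. ring.
      * transitivity (RtoC 1 * branch_x (c 1) 1 y t 0)%C; [rewrite b1|]; ring.
      * transitivity (RtoC (-1) * branch_x (c (-1)) (-1) y t 0)%C;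
          [rewrite b2, ep, em |]; ring.
Qed.
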